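(* For every integer $n\ge 0$, the sum of the weights of all Motzkin paths of length $n$ equals $c_n(t)$, where $c_0(t)=1$ and, for $n\ge 1$, $$c_n(t) = \sum_{j=0}^{n} \binom{\lfloor (n-1)/2 \rfloor}{\lfloor (j-1)/2 \rfloor} \binom{\lfloor n/2 \rfloor}{\lfloor j/2 \rfloor} t^{j-1}.$$
   Context: A Motzkin path of length $n$ is a lattice path from $(0,0)$ to $(n,0)$ that never goes below the $x$-axis and consists of $n$ steps, each an up-step $(1,1)$, a down-step $(1,-1)$ or a horizontal step $(1,0)$. Let $t$ be an indeterminate. Steps get the following weights: every up-step has weight $1$; every down-step has weight $t$; every horizontal step at height $0$ has weight $1$; every horizontal step at a positive even height has weight $1-t$; every horizontal step at an odd height has weight $t-1$. The weight of a path is the product of the weights of its steps (the empty path has weight $1$). Binomial coefficients with negative lower index are $0$, so the $j=0$ term of the sum vanishes. *)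

(* Defs.v *)
From HB Require Import structures.
From mathcomp Require Import all_boot all_order all_algebra.

Set Implicit Arguments.
Unset Strict Implicit.
Unset Printing Implicit Defensive.

Import Order.TTheory GRing.Theory Num.Theory.
Local Open Scope ring_scope.

Inductive step : predArgType := Up | Down | Level.

Definition option_bool_of_step (a : step) : option bool :=
  match a with Up => Some true | Down => Some false | Level => None end.

Definition step_of_option_bool (b : option bool) : step :=
  match b with Some true => Up | Some false => Down | None => Level end.

Lemma option_bool_of_stepK : cancel option_bool_of_step step_of_option_bool.
Proof. by case. Qed.

HB.instance Definition _ := Finite.copy step (can_type option_bool_of_stepK).

Definition rise (a : step) : int :=
  match a with Up => 1 | Down => -1 | Level => 0 end.

(* A path starting at (0, 0) is encoded by its sequence of steps; the vertex  *)
(* reached after i steps is (i, height p i).                                  *)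
Definition height (p : seq step) (i : nat) : int := \sum_(a <- take i p) rise a.

Definition motzkin (n : nat) (p : n.-tuple step) : bool :=
  [forall i : 'I_n.+1, 0 <= height p i] && (height p n == 0).

(* h is the height of the starting point of the step.                         *)
Definition step_weight (h : int) (a : step) : {poly int} :=
  match a with
  | Up => 1
  | Down => 'X
  | Level => if h == 0 then 1 else if (2 %| h)%Z then 1 - 'X else 'X - 1
  end.

Definition path_weight (n : nat) (p : n.-tuple step) : {poly int} :=
  \prod_(i < n) step_weight (height p i) (tnth p i).

(* Binomial coefficient with integer lower index, 0 when that is negative.    *)
Definition binz (m : nat) (k : int) : nat :=
  if k is Posz l then 'C(m, l) else 0%N.

(* (_ %/ 2)%Z is the floor of the half. The exponent j.-1 differs from j - 1  *)
(* only for j = 0, where the first binomial coefficient is 0.                 *)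
Definition c (n : nat) : {poly int} :=
  if n == 0%N then 1 else
  \sum_(0 <= j < n.+1)
    (binz (n.-1)./2 ((j%:Z - 1) %/ 2)%Z * 'C(n./2, j./2))%:R * 'X^(j.-1).

(* Main.v *)
Require Import Defs.
From mathcomp Require Import all_boot all_order all_algebra.
From mathcomp Require Import zify ring.

Import Order.TTheory GRing.Theory Num.Theory.
Local Open Scope ring_scope.

(** Write t for the indeterminate, and let B(n, h) be the total weight of the
paths of length n that start at height h, never go below 0 and end at height 0.
The theorem concerns B(n, 0). Splitting off the first step gives
  B(n+1, h) = B(n, h+1) + w(h) B(n, h) + t B(n, h-1),
where w(h) is the weight of a level step at height h ([descent_sumS]).

Because w alternates between 1-t and t-1, the polynomials B(n, h) pair up: with
n = 2m they satisfy B(n, 2k-1) = B(n, 2k) = t^(2k) E(m, k), and with n = 2m+1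
they satisfy B(n, 2k+1) = t B(n, 2k) = t^(2k+1) O(m, k). On these pairs the
recurrence loses all its signs and becomes
  O(m, k) = E(m, k) + t^2 E(m, k+1),
  E(m+1, k+1) = O(m, k+1) + O(m, k),    E(m+1, 0) = (1 + t) O(m, 0),
the last equation reflecting the exceptional weight 1 at height 0. All three are
Pascal's rule for the polynomials
  binprod a b k = sum over i of C(a, floor(i/2)) C(b, ceil(i/2) + k) t^i,
applied to the first or to the second binomial ([binprodSl], [binprodSr],
[binprod_diagS]). Hence O(m, k) = binprod m m k and E(m, k) = binprod (m-1) m k,
with m-1 read as 0 for m = 0 ([descent_sum_odd], [descent_sum_even]). At h = 0
both cases give binprod (floor((n-1)/2)) (floor(n/2)) 0, which is the polynomial
of the theorem with the summation index shifted by one ([c_binprod]). *)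

(** The starting height is a parameter, so that removing the first step of a
path leaves an object of the same kind. *)
Definition descent {n} (h : int) (p : n.-tuple step) : bool :=
  [forall i : 'I_n.+1, 0 <= h + height p i] && (h + height p n == 0).

Definition descent_weight {n} (h : int) (p : n.-tuple step) : {poly int} :=
  \prod_(i < n) step_weight (h + height p i) (tnth p i).

Definition descent_sum (n : nat) (h : int) : {poly int} :=
  \sum_(p : n.-tuple step | descent h p) descent_weight h p.

Lemma height_cons0 (p : seq step) : height p 0 = 0.
Proof. by rewrite /height take0 big_nil. Qed.

Lemma height_consS (a : step) (p : seq step) (i : nat) :
  height (a :: p) i.+1 = rise a + height p i.
Proof. by rewrite /height /= big_cons. Qed.

Lemma descent_cons n (h : int) (a : step) (p : n.-tuple step) :
  descent h [tuple of a :: p] = (0 <= h) && descent (h + rise a) p.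
Proof.
rewrite /descent height_consS addrA andbA; congr (_ && _).
apply/forallP/andP => [H | [h0 /forallP H] i].
  split; first by have := H ord0; rewrite height_cons0 addr0.
  by apply/forallP => i; have := H (lift ord0 i); rewrite height_consS addrA.
case: (unliftP ord0 i) => [j|] ->; last by rewrite height_cons0 addr0.
by rewrite height_consS addrA.
Qed.

Lemma descent_weight_cons n (h : int) (a : step) (p : n.-tuple step) :
  descent_weight h [tuple of a :: p]
  = step_weight h a * descent_weight (h + rise a) p.
Proof.
rewrite /descent_weight big_ord_recl height_cons0 addr0; congr (_ * _).
by apply: eq_bigr => i _; rewrite height_consS addrA tnthS.
Qed.

Lemma descent_sum_lt0 n (h : int) : h < 0 -> descent_sum n h = 0.
Proof.
move=> h0; rewrite /descent_sum big_pred0 // => p; apply/negP.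
by case/andP => /forallP/(_ ord0); rewrite height_cons0 addr0 leNgt h0.
Qed.

Lemma descent_sum0 (h : int) : descent_sum 0 h = (h == 0)%:R.
Proof.
rewrite /descent_sum big_mkcond (big_pred1 [tuple]); last first.
  by move=> p; apply/esym/eqP; exact: tuple0.
rewrite /descent_weight big_ord0 /descent height_cons0 addr0.
case: (h =P 0) => [->|_]; last by rewrite andbF.
by rewrite andbT; case: forallP => // -[] i; rewrite ord1 height_cons0.
Qed.

Lemma sum_step (f : step -> {poly int}) :
  \sum_a f a = f Up + f Level + f Down.
Proof.
rewrite (bigD1 Up) //= (bigD1 Level) //= (bigD1 Down) //= big1 ?addr0 ?addrA //.
by case.
Qed.

(** The missing factor in front of the first summand is the weight 1 of an
up-step. For h = 0 the last summand vanishes by [descent_sum_lt0]. *)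
Lemma descent_sumS n (h : int) : 0 <= h ->
  descent_sum n.+1 h = descent_sum n (h + 1)
    + step_weight h Level * descent_sum n h + 'X * descent_sum n (h - 1).
Proof.
move=> h0; rewrite /descent_sum.
rewrite (reindex (fun ap : step * n.-tuple step => [tuple of ap.1 :: ap.2])) /=.
  rewrite (eq_bigl (fun ap => descent (h + rise ap.1) ap.2)); last first.
    by case=> a p; rewrite descent_cons h0.
  under eq_bigr => ap _ do rewrite descent_weight_cons.
  rewrite -(pair_big_dep xpredT (fun a p => descent (h + rise a) p)
    (fun a p => step_weight h a * descent_weight (h + rise a) p)) /=.
  by rewrite sum_step -!mulr_sumr mul1r addr0.
exists (fun p => (thead p, [tuple of behead p])) => [[a p] _|p _] /=.
  by rewrite theadE; congr pair; apply: val_inj.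
by rewrite -tuple_eta.
Qed.

(** The truncation degree is immaterial: the first binomial coefficient vanishes
from there on ([coef_binprod]). *)
Definition binprod (a b k : nat) : {poly int} :=
  \poly_(i < a.+1.*2) ('C(a, i./2) * 'C(b, uphalf i + k))%:R.

Lemma coef_binprod a b k i :
  (binprod a b k)`_i = ('C(a, i./2) * 'C(b, uphalf i + k))%:R.
Proof.
rewrite coef_poly; case: ltnP => // hi.
by rewrite bin_small //; lia.
Qed.

(** Pascal's rule for the first binomial: lowering i by 2 lowers floor(i/2) by 1
while raising the shift k makes up for the change of ceil(i/2). *)
Lemma binprodSl a b k :
  binprod a.+1 b k = binprod a b k + 'X^2 * binprod a b k.+1.
Proof.
apply/polyP => -[|[|i]]; rewrite coefD coefXnM !coef_binprod /=.
- by rewrite !bin0 addr0.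
- by rewrite !bin0 addr0.
by rewrite subn2 /= -natrD binS mulnDl !addSn !addnS.
Qed.

Lemma binprodSr a b k :
  binprod a b.+1 k.+1 = binprod a b k.+1 + binprod a b k.
Proof.
by apply/polyP => i; rewrite coefD !coef_binprod -natrD addnS binS mulnDr.
Qed.

(** For k = 0, Pascal's rule for the second binomial produces the lower index
ceil(i/2) - 1, which is floor((i-1)/2). Since floor(i/2) = ceil((i-1)/2), the
two binomials exchange their roles, and for equal upper indices this is the
original sum multiplied by 'X. *)
Lemma binprod_diagS a : binprod a a.+1 0 = (1 + 'X) * binprod a a 0.
Proof.
apply/polyP => -[|i]; rewrite mulrDl mul1r coefD coefXM !coef_binprod /=.
  by rewrite !bin0 addr0.
by rewrite !addn0 -natrD binS mulnDr [('C(a, i./2) * _)%N]mulnC.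
Qed.

Lemma binprod00 k : binprod 0 0 k = (k == 0)%:R.
Proof.
apply/polyP => i; rewrite coef_binprod bin0n bin0n mulnb -polyC_natr coefC.
by case: i k => [|[|i]] [|k].
Qed.

Lemma step_weight_Level (h : nat) :
  step_weight h Level
  = if h == 0%N then 1 else if odd h then 'X - 1 else 1 - 'X.
Proof.
rewrite /step_weight eqz_nat; case: eqP => // _.
by case: ifP; case: ifP => //; lia.
Qed.

(** Half of the induction on the length: the step from 2m to 2m + 1. *)
Lemma descent_sum_odd m :
  (forall h : nat, descent_sum m.*2 h
     = 'X^((uphalf h).*2) * binprod m.-1 m (uphalf h)) ->
  forall h : nat, descent_sum m.*2.+1 h = 'X^h * binprod m m h./2.
Proof.
move=> even_m.
(* For m = 0 the upper index m.-1 does not grow, but then the extra term is 0. *)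
have binprodE k : binprod m m k = binprod m.-1 m k + 'X^2 * binprod m.-1 m k.+1.
  case: m {even_m} => [|m]; last exact: binprodSl.
  by rewrite !binprod00 mulr0 addr0.
move=> h; rewrite descent_sumS // step_weight_Level.
have [k [->|->]] : exists k, h = k.*2 \/ h = k.*2.+1.
  by exists h./2; lia.
- have -> : k.*2%:Z + 1 = k.*2.+1%:Z by lia.
  rewrite !even_m /= doubleK odd_double uphalf_double binprodE.
  case: k => [|k].
    by rewrite descent_sum_lt0 //; ring.
  have -> : k.+1.*2%:Z - 1 = k.*2.+1%:Z by lia.
  rewrite even_m /= doubleK.
  by rewrite !doubleS !exprS; ring.
have -> : k.*2.+1%:Z + 1 = k.+1.*2%:Z by lia.
have -> : k.*2.+1%:Z - 1 = k.*2%:Z by lia.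
rewrite !even_m /= odd_double !uphalf_double /= doubleK binprodE.
by rewrite !doubleS !exprS; ring.
Qed.

Lemma descent_sum_even m (h : nat) :
  descent_sum m.*2 h = 'X^((uphalf h).*2) * binprod m.-1 m (uphalf h).
Proof.
elim: m h => [|m /descent_sum_odd odd_m] h.
  by rewrite descent_sum0 binprod00; case: h => [|h]; rewrite ?mulr1 ?mulr0.
rewrite doubleS descent_sumS // step_weight_Level.
have [k [->|->]] : exists k, h = k.*2 \/ h = k.*2.+1.
  by exists h./2; lia.
- have -> : k.*2%:Z + 1 = k.*2.+1%:Z by lia.
  rewrite !odd_m /= odd_double doubleK uphalf_double.
  case: k => [|k].
    rewrite descent_sum_lt0 // binprod_diagS.
    by rewrite !expr0; ring.
  have -> : k.+1.*2%:Z - 1 = k.*2.+1%:Z by lia.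
  rewrite odd_m /= uphalf_double binprodSr.
  by rewrite !doubleS !exprS; ring.
have -> : k.*2.+1%:Z + 1 = k.+1.*2%:Z by lia.
have -> : k.*2.+1%:Z - 1 = k.*2%:Z by lia.
rewrite !odd_m /= odd_double !doubleK uphalf_double binprodSr.
by rewrite /= !doubleS !exprS; ring.
Qed.

Lemma descent_sum_at0 n : descent_sum n 0 = binprod (n.-1)./2 n./2 0.
Proof.
rewrite -[n]odd_double_half; case: (odd n) => /=.
  rewrite add1n (descent_sum_odd _ (descent_sum_even _) 0) mul1r /=.
  by rewrite doubleK uphalf_double.
rewrite add0n (descent_sum_even _ 0) mul1r /= doubleK.
by case: n./2 => // m; rewrite doubleS /= uphalf_double.
Qed.

(** The summand of index 0 in [c] is 0, and the summand of index i + 1 is the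
monomial of degree i in [binprod]. *)
Lemma c_binprod n : c n = binprod (n.-1)./2 n./2 0.
Proof.
case: n => [|n]; first by rewrite binprod00.
rewrite /c big_nat_recl // mul0n mul0r add0r.
have binz_half (j : nat) : binz n./2 ((j.+1%:Z - 1) %/ 2)%Z = 'C(n./2, j./2).
  have -> : ((j.+1%:Z - 1) %/ 2)%Z = j./2 by lia.
  by [].
under eq_bigr => j _ do rewrite binz_half.
apply/polyP => i; rewrite coef_binprod big_mkord coef_sum /=.
under eq_bigr => j _ do rewrite -polyC_natr coefCM coefXn.
have [lt_in | le_ni] := ltnP i n.+1.
  rewrite (bigD1 (Ordinal lt_in)) //= eqxx mulr1 big1 ?addr0 ?addn0 // => j.
  by rewrite -val_eqE /= eq_sym => /negPf->; rewrite mulr0.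
rewrite big1 => [|j _]; last first.
  have -> : (i == j) = false by have := ltn_ord j; lia.
  by rewrite mulr0.
(* Past degree n one of the two lower indices exceeds its upper index; which one
   depends on the parity of n. *)
have [lt1 | lt2] : (n./2 < i./2 \/ uphalf n < uphalf i)%N by lia.
  by rewrite bin_small.
by rewrite addn0 (bin_small lt2) muln0.
Qed.

Theorem mainTheorem6 (n : nat) :
  \sum_(p : n.-tuple step | motzkin p) path_weight p = c n.
Proof.
rewrite c_binprod -descent_sum_at0; apply: eq_big => p => [|_].
  by rewrite /descent add0r; under [in RHS]eq_forallb => i do rewrite add0r.
by apply: eq_bigr => i _; rewrite add0r.
Qed.
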